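(* Let $\mathfrak{R}$ be an elementary divisor domain that is not a field, and $\mathbb{F}$ its field of fractions. Let $A\in\mathbb{F}^{n\times n}$, $B\in\mathbb{F}^{n\times m}$ and $C\in\mathbb{F}^{p\times n}$ be matrices such that $\det A\neq 0$, $A$ and $B$ are left coprime in $\mathfrak{R}$ and $A$ and $C$ are right coprime in $\mathfrak{R}$. Let $\alpha$, $\beta$ and $\gamma$ be least common denominators in $\mathfrak{R}$ of $A$, $B$ and $C$, respectively. Let $D\in\mathbb{F}^{p\times m}$ be a matrix such that $\frac{\beta\gamma}{\alpha}D\in\mathfrak{R}^{p\times m}$. Let $$P=\frac{1}{\beta\gamma}\begin{bmatrix} \alpha A & \beta B\\ \gamma C & \frac{\beta\gamma}{\alpha} D\end{bmatrix}\in \mathbb{F}^{(n+p)\times (n+m)}$$ and let $$S_P\doteq \frac{1}{\beta\gamma}I_n\oplus\operatorname{Diag}\left(\frac{\nu_1}{\delta_1},\ldots,\frac{\nu_r}{\delta_r}\right)\oplus 0_{(p-r)\times(m-r)}$$ be its Smith-McMillan form. If the Smith-McMillan form of $A$ is $$S_A\doteq \operatorname{Diag}\left(\frac{\beta_1}{\alpha_1},\ldots,\frac{\beta_n}{\alpha_n}\right),$$ then the Smith-McMillan form of $G=D-CA^{-1}B$ is $$S_G\doteq\operatorname{Diag}\left(\frac{\widetilde\alpha_n\widetilde\nu_1}{\widetilde\beta_n\widetilde\delta_1},\ldots,\frac{\widetilde\alpha_{n-r+1}\widetilde\nu_r}{\widetilde\beta_{n-r+1}\widetilde\delta_r}\right)\oplus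 0_{(p-r)\times(m-r)},$$ where $r=\operatorname{rank}P-n$, $$\mu_i=\gcd(\alpha_{n-i+1},\delta_i),\quad \widetilde\alpha_{n-i+1}=\frac{\alpha_{n-i+1}}{\mu_i},\quad \widetilde\delta_i=\frac{\delta_i}{\mu_i},\quad i=1,\ldots,r,$$ and $$\sigma_i=\gcd(\beta_{n-i+1},\nu_i),\quad \widetilde\beta_{n-i+1}=\frac{\beta_{n-i+1}}{\sigma_i},\quad \widetilde\nu_i=\frac{\nu_i}{\sigma_i},\quad i=1,\ldots,r.$$
   Context: An elementary divisor domain (EDD) is an integral domain $\mathfrak{R}$ such that every $a,b,c\in\mathfrak{R}$ have a greatest common divisor which can be written $\gcd(a,b,c)=zxa+zyb+wyc$ for some $x,y,z,w\in\mathfrak{R}$; equivalently, an integral domain over which every matrix $M$ is equivalent to one of the form $\operatorname{Diag}(a_1,\dots,a_s)\oplus 0$ with nonzero $a_1\mid\cdots\mid a_s$. A square matrix over $\mathfrak{R}$ is unimodular if it is invertible over $\mathfrak{R}$. Two matrices $M,N$ of the same size over $\mathbb{F}$ are equivalent if $UMV=N$ with $U,V$ unimodular over $\mathfrak{R}$. Smith-McMillan form of a matrix $H\in\mathbb{F}^{p\times m}$ of rank $s$: a matrix $\operatorname{Diag}(\varepsilon_1/\psi_1,\dots,\varepsilon_s/\psi_s)\oplus 0_{(p-s)\times(m-s)}$ equivalent to $H$, with nonzero $\varepsilon_i,\psi_i\in\mathfrak{R}$, $\varepsilon_1\mid\cdots\mid\varepsilon_s$, $\psi_s\mid\cdots\mid\psi_1$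 and $\gcd(\varepsilon_i,\psi_i)\doteq 1$ (unique up to units). The symbol $\doteq$ means equality up to multiplication by a unit of $\mathfrak{R}$ (for scalars) or by a diagonal unimodular matrix (for matrices); gcds and ''the'' Smith-McMillan form are understood up to $\doteq$. The displayed Smith-McMillan forms are read with the displayed numerators and denominators, which satisfy these divisibility and coprimeness conditions. Under the hypotheses, the Smith-McMillan form of $P$ always has the displayed shape with leading block $\frac{1}{\beta\gamma}I_n$. A least common denominator in $\mathfrak{R}$ of a matrix $H$ over $\mathbb{F}$ is a least common denominator of its entries: a nonzero $\tau\in\mathfrak{R}$ with $\tau H$ over $\mathfrak{R}$ that divides every nonzero $\tau'\in\mathfrak{R}$ with $\tau'H$ over $\mathfrak{R}$. The scalars $\alpha,\beta$ (without index) are not to be confused with $\alpha_i,\beta_i$. Coprimeness over $\mathfrak{R}$: $G_1\in\mathfrak{R}^{p\times m}$ and $G_2\in\mathfrak{R}^{q\times m}$ are right coprime if every $F\in\mathfrak{R}^{m\times m}$ with $G_1=\widetilde G_1F$, $G_2=\widetilde G_2F$ for some matrices $\widetilde G_1,\widetilde G_2$ over $\mathfrak{R}$ is unimodular; $H_1,H_2$ (same number of rows) are left coprime if $H_1^T,H_2^T$ are right coprime. Coprimeness of matrices over $\mathbb{F}$: matrices $T_1,T_2$ over $\mathbb{F}$ with least common denominators $\tau_1,\tau_2$ in $\mathfrak{R}$ are right (resp. left) coprime in $\mathfrak{R}$ if $\tau_1T_1$ and $\tau_2T_2$ are right (resp. left) coprime over $\mathfrak{R}$. $\oplus$ denotes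 the block diagonal sum; $0_{0\times q}$ (resp. $0_{p\times 0}$) in a direct sum means appending $q$ zero columns (resp. $p$ zero rows).
   Formalization: When r > n (possible, e.g. n = 1, A = (1), B = C = 0, D = I_2), the terms α_{n-i+1}, β_{n-i+1} with i > n are undefined in the statement; they are read as α and 1 respectively. For r ≤ n the statement is unchanged. *)

(* Defs.v *)
From HB Require Import structures.
From mathcomp Require Import all_boot all_order all_algebra.

Set Implicit Arguments.
Unset Strict Implicit.
Unset Printing Implicit Defensive.

Import GRing.Theory.
Local Open Scope ring_scope.

Notation "x %:F" := (@tofrac _ x) : ring_scope.

Section Domain.

Variable R : idomainType.
Local Notation F := {fraction R}.

Definition rdvd (a b : R) : Prop := exists c : R, b = c * a.

Definition is_gcd (g a b : R) : Prop :=
  [/\ rdvd g a, rdvd g b & forall d, rdvd d a -> rdvd d b -> rdvd d g].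

Definition is_gcd3 (g a b c : R) : Prop :=
  [/\ rdvd g a, rdvd g b, rdvd g c
    & forall d, rdvd d a -> rdvd d b -> rdvd d c -> rdvd d g].

Definition elementary_divisor_domain : Prop :=
  forall a b c : R, exists2 g : R, is_gcd3 g a b c &
    exists x y z w : R, g = z * x * a + z * y * b + w * y * c.

Definition not_a_field : Prop := exists2 x : R, x != 0 & x \isn't a GRing.unit.

Definition over_R (p m : nat) (H : 'M[F]_(p, m)) : Prop :=
  exists N : 'M[R]_(p, m), H = map_mx (@tofrac R) N.

Definition is_lcd (p m : nat) (t : R) (H : 'M[F]_(p, m)) : Prop :=
  [/\ t != 0, over_R (t%:F *: H)
    & forall t' : R, t' != 0 -> over_R (t'%:F *: H) -> rdvd t t'].

Definition right_coprime_R (p q m : nat)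
    (G1 : 'M[R]_(p, m)) (G2 : 'M[R]_(q, m)) : Prop :=
  forall E : 'M[R]_m,
    (exists G1' : 'M[R]_(p, m), G1 = G1' *m E) ->
    (exists G2' : 'M[R]_(q, m), G2 = G2' *m E) ->
    E \in unitmx.

Definition left_coprime_R (m p q : nat)
    (H1 : 'M[R]_(m, p)) (H2 : 'M[R]_(m, q)) : Prop :=
  right_coprime_R H1^T H2^T.

Definition right_coprime (p q m : nat)
    (T1 : 'M[F]_(p, m)) (T2 : 'M[F]_(q, m)) : Prop :=
  exists (t1 t2 : R) (N1 : 'M[R]_(p, m)) (N2 : 'M[R]_(q, m)),
    [/\ is_lcd t1 T1 /\ is_lcd t2 T2,
        t1%:F *: T1 = map_mx (@tofrac R) N1,
        t2%:F *: T2 = map_mx (@tofrac R) N2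
      & right_coprime_R N1 N2].

Definition left_coprime (m p q : nat)
    (T1 : 'M[F]_(m, p)) (T2 : 'M[F]_(m, q)) : Prop :=
  exists (t1 t2 : R) (N1 : 'M[R]_(m, p)) (N2 : 'M[R]_(m, q)),
    [/\ is_lcd t1 T1 /\ is_lcd t2 T2,
        t1%:F *: T1 = map_mx (@tofrac R) N1,
        t2%:F *: T2 = map_mx (@tofrac R) N2
      & left_coprime_R N1 N2].

Definition equivalent_mx (p m : nat) (M N : 'M[F]_(p, m)) : Prop :=
  exists (U : 'M[R]_p) (V : 'M[R]_m),
    [/\ U \in unitmx, V \in unitmx
      & map_mx (@tofrac R) U *m M *m map_mx (@tofrac R) V = N].

(* Diag(e_0/f_0, e_1/f_1, ...) (+) 0: past the end of e the numerator defaults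
   to 0. *)
Definition diag_frac (p m : nat) (e f : seq R) : 'M[F]_(p, m) :=
  \matrix_(i, j) ((nth 0 e i)%:F / (nth 1 f i)%:F *+ (i == j :> nat)).

(* The fractions displayed are e_i / f_i (e for epsilon, f for psi). Since
   size e = \rank H, diag_frac p m e truncates nothing. *)
Definition smith_mcmillan_form (p m : nat) (H : 'M[F]_(p, m)) (e f : seq R) :
    Prop :=
  [/\ size e = \rank H /\ size f = \rank H,
      forall i, (i < \rank H)%N -> e`_i != 0 /\ f`_i != 0,
      forall i, (i.+1 < \rank H)%N -> rdvd e`_i e`_i.+1 /\ rdvd f`_i.+1 f`_i,
      forall i, (i < \rank H)%N -> is_gcd 1 e`_i f`_i
    & equivalent_mx H (diag_frac p m e f)].

(* For s = (s_1, ..., s_n), from_end x s i is s_{n-i} when i < n; the value x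
   stands for the missing terms s_0, s_{-1}, ... when i >= n. *)
Definition from_end (x : R) (s : seq R) (i : nat) : R := nth x (rev s) i.

End Domain.

(* Main.v *)
(* Put NA = alpha A, NB = beta B, NC = gamma C, ND = (beta gamma / alpha) D, so
   that G = alpha / (beta gamma) W for W = ND - NC NA^-1 NB. By coprimeness
   [NA NB] can be completed to a unimodular matrix; the same column operations
   reduce the system matrix [NA NB; NC ND] to I + E (direct sum), and NA + I to
   I + T, where W = E T^-1 is a right coprime fraction. If S = Eps Psi^-1 is the
   Smith-McMillan form of W, uniqueness of right coprime fractions makes E
   equivalent to Eps and T to Psi. Invariant factors are unique (compare the
   divisors of the k-minors), so Eps carries the last r invariant factors d_i
   of the system matrix and Psi those of NA in reverse order: W is equivalent
   to Diag(d_i / a_(n-i+1)). Substituting d_i = beta gamma nu_i / delta_i and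
   a_j = alpha beta_j / alpha_j, the entries of S_G are alpha_(n-i+1) nu_i /
   (beta_(n-i+1) delta_i) written in lowest terms. *)

Require Import Defs.
From mathcomp Require Import all_boot all_order all_algebra.
From mathcomp Require Import perm ring.

Set Implicit Arguments.
Unset Strict Implicit.
Unset Printing Implicit Defensive.

Import GRing.Theory.
Local Open Scope ring_scope.

(** * Divisibility, comaximality and Bezout identities *)

Section Divisibility.
Variable R : idomainType.
Implicit Types a b c d u v : R.

Lemma rdvdxx a : rdvd a a.
Proof. by exists 1; rewrite mul1r. Qed.

Lemma rdvd_trans b a c : rdvd a b -> rdvd b c -> rdvd a c.
Proof. by move=> [x ->] [y ->]; exists (y * x); rewrite mulrA. Qed.

Lemma rdvd0 a : rdvd a 0.
Proof. by exists 0; rewrite mul0r. Qed.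

Lemma rdvdM a b c d : rdvd a b -> rdvd c d -> rdvd (a * c) (b * d).
Proof. by move=> [x ->] [y ->]; exists (x * y); rewrite mulrACA. Qed.

Lemma rdvd_antisym a b : rdvd a b -> rdvd b a -> a != 0 ->
  exists2 u, u \is a GRing.unit & b = u * a.
Proof.
move=> [x ->] [y e] a0; exists x => //.
by apply/unitrPr; exists y; apply: (mulIf a0); rewrite mul1r {2}e; ring.
Qed.

Lemma rdvd_chain (f : nat -> R) : (forall i, rdvd (f i) (f i.+1)) ->
  forall i j, (i <= j)%N -> rdvd (f i) (f j).
Proof.
move=> ch i; elim=> [|j IH]; first by rewrite leqn0 => /eqP ->; apply: rdvdxx.
rewrite leq_eqVlt => /predU1P[-> | /IH]; first exact: rdvdxx.
by move/rdvd_trans; apply.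
Qed.

Lemma rdvd_chain_nth (s : seq R) :
  (forall i, (i.+1 < size s)%N -> rdvd s`_i s`_i.+1) ->
  forall i, rdvd s`_i s`_i.+1.
Proof.
move=> ch i; case: (ltnP i.+1 (size s)) => [/ch //|ge].
by rewrite [s`_i.+1]nth_default //; apply: rdvd0.
Qed.

(** Coprimeness as a Bezout identity, which passes to products and factors by plain algebra; over an
    elementary divisor domain it agrees with having gcd 1. *)
Definition comaximal a b : Prop := exists u v, u * a + v * b = 1.

Lemma comaximalC a b : comaximal a b -> comaximal b a.
Proof. by move=> [u [v e]]; exists v, u; rewrite addrC. Qed.

Lemma comaximalMl a b c : comaximal a c -> comaximal b c -> comaximal (a * b) c.
Proof.
move=> [u [v e]] [u' [v' e']]; 
exists (u * u'), (u * a * v' + v * u' * b + v * v' * c).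
by rewrite -[RHS](mulr1 1) -{1}e -e'; ring.
Qed.

Lemma comaximal_factorl x a b : comaximal (x * a) b -> comaximal a b.
Proof. by move=> [u [v e]]; exists (u * x), v; rewrite -mulrA. Qed.

Lemma comaximal_rdvd a b c : comaximal a b -> rdvd a (b * c) -> rdvd a c.
Proof.
move=> [u [v e]] [x ex]; exists (u * c + v * x).
by rewrite mulrDl -[v * x * a]mulrA -ex -[LHS]mul1r -e; ring.
Qed.

Lemma comaximal_is_gcd a b : comaximal a b -> is_gcd 1 a b.
Proof.
move=> [u [v e]]; split; [by exists a; rewrite mulr1|by exists b; rewrite mulr1|].
by move=> d [x ea] [y eb]; exists (u * x + v * y); rewrite -e ea eb; ring.
Qed.

(** The hypothesis is the cross-multiplied form of c/d = x (a/b). It gives the divisibility chains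
    of numerators and denominators once consecutive reduced fractions differ by a factor in [R]. *)
Lemma lowest_terms_chain a b c d x : b != 0 -> d != 0 ->
  comaximal a b -> comaximal c d -> c * b = x * a * d ->
  rdvd a c /\ rdvd d b.
Proof.
move=> b0 d0 ab cd e; split.
  by apply: (comaximal_rdvd ab); exists (x * d); rewrite mulrC e; ring.
by apply: (comaximal_rdvd (comaximalC cd)); exists (x * a).
Qed.

(** Opposite direction: here [x] = t a/b and [y] = t c/d, so the chains of numerators and
    denominators yield a chain of scaled values. *)
Lemma rdvd_scaled_chain t a b c d x y : b != 0 ->
  rdvd a c -> rdvd d b -> t * a = x * b -> t * c = y * d -> rdvd x y.
Proof.
move=> b0 [k ->] [l eb] e1 e2; exists (l * k); apply: (mulIf b0).
by rewrite -mulrA -e1 {1}eb mulrCA -e2; ring.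
Qed.

Hypothesis hEDD : elementary_divisor_domain R.

(** The three-term identity with c = 0, divided by g. If g = 0 then a = b = 0, and the cofactors 1
    and 0 are chosen by hand. *)
Lemma EDD_bezout a b : exists g u v a' b',
  [/\ a = a' * g, b = b' * g & u * a' + v * b' = 1].
Proof.
have [g [[a' ea] [b' eb] _ _] [x [y [z [w eg]]]]] := hEDD a b 0.
have [g0|g0] := eqVneq g 0.
  exists 0, 1, 0, 1, 0; split; last by ring.
    by rewrite ea g0 !mulr0.
  by rewrite eb g0 !mulr0.
exists g, (z * x), (z * y), a', b'; split=> //; apply: (mulIf g0).
by rewrite mul1r [RHS]eg [in RHS]ea [in RHS]eb; ring.
Qed.

(** Any gcd is a multiple of the Bezout divisor [h], hence itself a combination of a and b; then [g]
    cancels. *)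
Lemma is_gcd_comaximal a b g a' b' : is_gcd g a b -> g != 0 ->
  a = a' * g -> b = b' * g -> comaximal a' b'.
Proof.
move=> [_ _ hg] g0 ea eb.
have [h [u [v [a1 [b1 [ea1 eb1 e]]]]]] := EDD_bezout a b.
have [c ec] : rdvd h g by apply: hg; [exists a1 | exists b1].
exists (u * c), (v * c); apply: (mulIf g0).
rewrite mulrDl -2![_ * _ * g]mulrA -ea -eb ea1 eb1 [in RHS]ec -[RHS]mulr1 mul1r -e.
ring.
Qed.

Lemma is_gcd1_comaximal a b : is_gcd 1 a b -> comaximal a b.
Proof. by move/is_gcd_comaximal; apply; rewrite ?oner_neq0 ?mulr1. Qed.

End Divisibility.

(** * Rectangular diagonal matrices *)

Section RectangularDiagonal.
Variable K : comNzRingType.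

(** The diagonal is a function on [nat], so that one function serves matrices of every size and can
    be shifted or padded freely. *)
Definition dmx (p m : nat) (f : nat -> K) : 'M[K]_(p, m) :=
  \matrix_(i, j) (f i *+ (i == j :> nat)).

Lemma eq_dmx p m (f g : nat -> K) :
  (forall i, (i < p)%N -> (i < m)%N -> f i = g i) -> dmx p m f = dmx p m g.
Proof.
move=> fg; apply/matrixP=> i j; rewrite !mxE; case: eqP => // e.
by rewrite fg // e.
Qed.

Lemma dmx1 n : dmx n n (fun _ => 1) = 1%:M.
Proof. by apply/matrixP=> i j; rewrite !mxE. Qed.

Lemma dmx_diag n f : dmx n n f = diag_mx (\row_i f i).
Proof. by apply/matrixP=> i j; rewrite !mxE -val_eqE. Qed.

Lemma scale_dmx p m c f : c *: dmx p m f = dmx p m (fun i => c * f i).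
Proof. by apply/matrixP=> i j; rewrite !mxE mulrnAr. Qed.

Lemma add_dmx p m f g : dmx p m f + dmx p m g = dmx p m (fun i => f i + g i).
Proof. by apply/matrixP=> i j; rewrite !mxE mulrnDl. Qed.

(** If the inner dimension m is the smallest, the diagonal of the product stops at m; the side
    condition makes the formula agree there. *)
Lemma mul_dmx p m q f g :
  (forall i, (m <= i < minn p q)%N -> f i * g i = 0) ->
  dmx p m f *m dmx m q g = dmx p q (fun i => f i * g i).
Proof.
move=> fg; apply/matrixP=> i j; rewrite !mxE.
case: (ltnP i m) => [im|mi].
  rewrite (bigD1 (Ordinal im)) //= !mxE eqxx mulr1n mulrnAr big1 ?addr0 // => k.
  by rewrite -val_eqE /= !mxE eq_sym => /negPf ->; rewrite mul0r.
rewrite big1; last first.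
  move=> k _; rewrite !mxE [_ == k :> nat]gtn_eqF ?mul0r //.
  exact: leq_trans (ltn_ord k) mi.
by case: eqP => //= e; rewrite fg // mi leq_min ltn_ord e ltn_ord.
Qed.

Lemma mul_dmx_wide p m q f g : (minn p q <= m)%N ->
  dmx p m f *m dmx m q g = dmx p q (fun i => f i * g i).
Proof.
move=> le; apply: mul_dmx => i /andP[mi /leq_trans/(_ le)].
by rewrite ltnNge mi.
Qed.

Lemma block_dmx n p m f g :
  block_mx (dmx n n f) 0 0 (dmx p m g) =
  dmx (n + p) (n + m) (fun i => if (i < n)%N then f i else g (i - n)%N).
Proof.
apply/matrixP=> i j; rewrite !mxE.
case: splitP => i' ->; rewrite !mxE; case: splitP => j' ->; rewrite !mxE //.
- by rewrite ltn_eqF // ltn_addr.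
- by rewrite gtn_eqF // ltn_addr.
- by rewrite addKn eqn_add2l.
Qed.

Lemma dmx_addm p m f : dmx (m + p) m f = col_mx (dmx m m f) 0.
Proof.
apply/matrixP=> i j; rewrite !mxE; case: splitP => i' -> ; rewrite !mxE //.
by rewrite gtn_eqF // ltn_addr.
Qed.

End RectangularDiagonal.

(** * Equivalence of matrices over the ring *)

Section Equivalence.
Variable R : idomainType.

Definition equiv_over_R (p m : nat) (M N : 'M[R]_(p, m)) : Prop :=
  exists U V, [/\ U \in unitmx, V \in unitmx & U *m M *m V = N].

Lemma equiv_over_R_sym p m (M N : 'M[R]_(p, m)) :
  equiv_over_R M N -> equiv_over_R N M.
Proof.
move=> [U [V [uU uV <-]]]; exists (invmx U), (invmx V).
by rewrite !unitmx_inv -!mulmxA mulmxV // mulmx1 mulKmx.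
Qed.

Lemma equiv_over_R_trans p m (N M L : 'M[R]_(p, m)) :
  equiv_over_R M N -> equiv_over_R N L -> equiv_over_R M L.
Proof.
move=> [U [V [uU uV <-]]] [U' [V' [uU' uV' <-]]]; exists (U' *m U), (V *m V').
by rewrite !unitmx_mul uU uU' uV uV' !mulmxA.
Qed.

Lemma equiv_over_R_diag n p m (M N : 'M[R]_(p, m)) :
  equiv_over_R M N ->
  equiv_over_R (block_mx (1%:M : 'M_n) 0 0 M) (block_mx 1%:M 0 0 N).
Proof.
move=> [U [V [uU uV <-]]].
exists (block_mx 1%:M 0 0 U), (block_mx 1%:M 0 0 V).
by rewrite !unitmxE !det_ublock !det1 !mul1r -!unitmxE uU uV !mulmx_block
  !(mul0mx, mulmx0, mul1mx, mulmx1, addr0, add0r).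
Qed.

Lemma equiv_over_R_diagl n p m (M N : 'M[R]_(p, m)) :
  equiv_over_R M N ->
  equiv_over_R (block_mx M 0 0 (1%:M : 'M_n)) (block_mx N 0 0 1%:M).
Proof.
move=> [U [V [uU uV <-]]].
exists (block_mx U 0 0 1%:M), (block_mx V 0 0 1%:M).
by rewrite !unitmxE !det_ublock !det1 !mulr1 -!unitmxE uU uV !mulmx_block
  !(mul0mx, mulmx0, mul1mx, mulmx1, addr0, add0r).
Qed.

Lemma equiv_dmx_perm n (s t : seq R) : size s = n -> perm_eq s t ->
  equiv_over_R (dmx n n (nth 0 s)) (dmx n n (nth 0 t)).
Proof.
move=> <- st.
have/tuple_permP[p es] : perm_eq t (in_tuple s) by rewrite perm_sym.
exists (perm_mx p), (perm_mx p^-1); rewrite !unitmx_perm; split=> //.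
rewrite -col_permE -row_permE; apply/matrixP=> i j; rewrite !mxE.
have -> : t`_i = s`_(p i).
  by rewrite es -tnth_nth tnth_mktuple (tnth_nth 0).
by rewrite !val_eqE (inj_eq perm_inj).
Qed.

End Equivalence.

(** * Existence of the Smith form *)

Section SmithForm.
Variable R : idomainType.
Hypothesis hEDD : elementary_divisor_domain R.

(** Induction on the length: the Bezout identity merges the first entry with the content of the
    remaining ones, which is attained at [v0]. *)
Lemma row_content m (r : 'rV[R]_m) : exists g r' v,
  r = g *: r' /\ r *m v = g%:M :> 'M_1.
Proof.
elim: m r => [|m IH] r.
  exists 0, 0, 0; split; last by rewrite mulmx0 raddf0.
  by apply/matrixP=> i [].
rewrite -[r]/(r : 'rV_(1 + m)) -[r](@hsubmxK _ _ 1).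
set a := lsubmx _; have [g0 [r0 [v0 [e1 e2]]]] := IH (rsubmx (r : 'rV_(1 + m))).
have [g [u [v [a' [b' [ea eb e]]]]]] := EDD_bezout hEDD (a 0 0) g0.
exists g, (row_mx a'%:M (b' *: r0)), (col_mx u%:M (v *: v0)); split.
  rewrite (@scale_row_mx _ _ 1) [a]mx11_scalar ea e1 eb.
  by rewrite scale_scalar_mx scalerA ![g * _]mulrC.
rewrite (@mul_row_col _ _ 1) -scalemxAr e2 [a]mx11_scalar.
rewrite scale_scalar_mx -scalar_mxM -raddfD /=.
by congr _%:M; rewrite ea eb -[RHS]mulr1 -e; ring.
Qed.

(* Induction on the rows: if [M0] has content [a] attained at [(u0, v0)], then
   [R^m] is spanned by [v0] and the kernel of the row [s' = u0 M0 / a]; the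
   new row [r] is determined by [b = r v0] and by its restriction to that
   kernel, of content [c], and the EDD identity for [a, b, c] applies. *)
Lemma matrix_content p m (M : 'M[R]_(p, m)) : exists g M' u v,
  M = g *: M' /\ u *m M *m v = g%:M :> 'M_1.
Proof.
elim: p M => [|p IH] M.
  exists 0, 0, 0, 0; rewrite !mul0mx; split; last by rewrite raddf0.
  by apply/matrixP => [] [].
rewrite -[M]/(M : 'M_(1 + p, m)) -[M](@vsubmxK _ 1).
set r := usubmx _.
have [a [M0' [u0 [v0 [e1 e2]]]]] := IH (dsubmx (M : 'M_(1 + p, m))).
set M0 := dsubmx (M : 'M_(1 + p, m)) in e1 e2 *.
have [a0|a0] := eqVneq a 0.
  have [g [r' [v [er ev]]]] := row_content r.
  exists g, (col_mx r' 0), (row_mx 1%:M 0), v.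
  rewrite (@scale_col_mx _ 1) scaler0 -er (@mul_row_col _ _ 1).
  by rewrite mul1mx mul0mx addr0 ev e1 a0 scale0r.
pose s' := u0 *m M0'.
have s'v0 : s' *m v0 = 1%:M.
  apply: (scalemx_inj a0); rewrite /s' scalemxAl scalemxAr -e1 e2.
  by rewrite scale_scalar_mx mulr1.
pose b := (r *m v0) 0 0.
have eb : r *m v0 = b%:M by rewrite [LHS]mx11_scalar.
pose rho := r - b *: s'.
have [c [rho' [t [erho et]]]] := row_content rho.
pose t' := t - v0 *m (s' *m t).
have s't' : s' *m t' = 0 by rewrite mulmxBr (mulmxA s' v0) s'v0 mul1mx subrr.
have rt' : r *m t' = c%:M.
  by rewrite mulmxBr (mulmxA r v0) eb mul_scalar_mx scalemxAl -mulmxBl.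
have [g [[ka ea] [kb ebk] [kc ec] _] [x [y [z [w eg]]]]] := hEDD a b c.
exists g, (col_mx (kb *: s' + kc *: rho') (ka *: M0')), (row_mx y%:M (x *: u0)),
  (z *: v0 + w *: t'); split.
  rewrite (@scale_col_mx _ 1) scalerDr !scalerA ![g * _]mulrC -ebk -ec -ea.
  by rewrite -[c *: _]erho /rho addrC subrK e1.
rewrite (@mul_row_col _ _ 1) mul_scalar_mx -scalemxAl e1 -scalemxAr -/s'.
rewrite !mulmxDr !mulmxDl -!scalemxAl -!scalemxAr eb rt' s'v0 s't'.
rewrite !scaler0 addr0 !scale_scalar_mx -!raddfD /= eg.
by congr _%:M; ring.
Qed.

(** Elimination from the bottom: induction clears all entries below the second one, and a 2 x 2
    Bezout matrix clears the second against the first. *)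
Lemma column_reduction s (v : 'cV[R]_s) : exists2 U, U \in unitmx &
  forall i : 'I_s, (0 < i)%N -> (U *m v) i 0 = 0.
Proof.
elim: s v => [|[|s] IH] v.
- by exists 1%:M; [exact: unitmx1 | case].
- by exists 1%:M; [exact: unitmx1 | move=> i; rewrite ord1].
have [U uU hU] := IH (dsubmx (v : 'cV_(1 + s.+1))).
pose w := block_mx 1%:M 0 0 U *m (v : 'cV_(1 + s.+1)).
have hw (i : 'I_s) : (w : 'cV_(2 + s)) (rshift 2 i) 0 = 0.
  rewrite /w -[v](@vsubmxK _ 1) (@mul_block_col _ 1 _ 1) !mul0mx add0r.
  have -> : rshift 2 i = rshift 1 (lift ord0 i) by apply: val_inj.
  by rewrite (@col_mxEd _ 1 s.+1 1) hU.
have ew : block_mx 1%:M 0 0 U *m (v : 'cV_(1 + s.+1)) = w by [].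
clearbody w.
have [g [x [y [a [b [ea eb e]]]]]] :=
  EDD_bezout hEDD ((w : 'cV_(2 + s)) 0 0) ((w : 'cV_(2 + s)) 1 0).
(* The rows of [B] are (x, y) and (-b, a): its determinant is x a + y b = 1, and it sends (a g, b g)
   to (g, 0). *)
pose B : 'M[R]_2 := \matrix_(i, j) nth 0 (nth [::] [:: [:: x; y]; [:: - b; a]] i) j.
have uB : (block_mx B 0 0 1%:M : 'M_(2 + s)) \in unitmx.
  rewrite unitmxE det_ublock det1 mulr1 (expand_det_row _ 0) !big_ord_recl.
  rewrite big_ord0 /cofactor !det_mx11 !mxE /=.
  rewrite /bump /= addn0 expr0 expr1.
  rewrite [X in X \is a _](_ : _ = x * a + y * b); first by rewrite e unitr1.
  ring.
have uU1 : (block_mx 1%:M 0 0 U : 'M_(1 + s.+1)) \in unitmx.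
  by rewrite unitmxE det_ublock det1 mul1r -unitmxE.
exists ((block_mx B 0 0 1%:M : 'M_(2 + s)) *m
  (block_mx 1%:M 0 0 U : 'M_(1 + s.+1))).
  by rewrite unitmx_mul; apply/andP; split.
move=> i i0; rewrite -mulmxA [_ *m v]ew -[w](@vsubmxK _ 2) (@mul_block_col _ 2 _ 2).
have -> : dsubmx (w : 'cV_(2 + s)) = 0.
  by apply/matrixP=> k l; rewrite mxE [l]ord1 hw mxE.
rewrite !mulmx0 mul0mx !addr0 -[i]/(i : 'I_(2 + s)) mxE.
case: splitP => [j ej|j _]; last by rewrite mxE.
rewrite mxE !big_ord_recl big_ord0 !mxE -!ej.
have -> : i = 1 :> nat by case: (i : nat) ej i0 (ltn_ord j) => [|[|k]] // <-.
have -> : lshift s (0 : 'I_2) = 0 by apply: val_inj.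
have -> : lshift s (lift ord0 0 : 'I_2) = 1 by apply: val_inj.
by rewrite /= ea eb; ring.
Qed.

(** Column reduction turns v into g times the first basis vector, and u v = 1 forces g to be a unit,
    which is absorbed into the inverse transformation. *)
Lemma unimodular_completion s (v : 'cV[R]_s.+1) (u : 'rV[R]_s.+1) :
  u *m v = 1%:M -> exists2 V, V \in unitmx & V *m delta_mx 0 0 = v.
Proof.
move=> uv; have [U uU hU] := column_reduction v.
pose g := (U *m v) 0 0.
have eU : U *m v = g *: delta_mx 0 0.
  apply/matrixP=> i j; rewrite [j]ord1 !mxE eqxx andbT.
  have [->|i0] := eqVneq i 0; first by rewrite mulr1 -[RHS]/((U *m v) 0 0) mxE.
  by have := hU i; rewrite mxE mulr0 lt0n => ->.
have ug : g \is a GRing.unit.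
  apply/unitrPr; exists ((u *m invmx U *m delta_mx 0 0 : 'M_1) 0 0).
  rewrite -[RHS](_ : (u *m v) 0 0 = 1); last by rewrite uv mxE.
  by rewrite -[v in RHS](mulKmx uU) eU -scalemxAr -scalemxAr mulmxA [in RHS]mxE.
exists (g *: invmx U); first by rewrite unitmxZ // unitmx_inv.
by rewrite -scalemxAl scalemxAr -eU mulKmx.
Qed.

(** Write M = g M' with u M' v = 1 and complete u and v to unimodular matrices: M' then acquires a
    corner entry 1, and induction applies to the Schur complement. As g multiplies all of M', it
    divides every later invariant factor. *)
Theorem Smith_form p m (M : 'M[R]_(p, m)) : exists d : seq R,
  [/\ (size d <= minn p m)%N, forall i, (i < size d)%N -> d`_i != 0,
      forall i, (i.+1 < size d)%N -> rdvd d`_i d`_i.+1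
    & equiv_over_R M (dmx p m (nth 0 d))].
Proof.
elim: p m M => [|p IH] m M.
  exists [::]; split=> //; exists 1%:M, 1%:M; rewrite !unitmx1; split=> //.
  by apply/matrixP => [] [].
have [->|nzM] := eqVneq M 0.
  exists [::]; split=> //; exists 1%:M, 1%:M; rewrite !unitmx1; split=> //.
  by rewrite mulmx0 mul0mx; apply/matrixP => i j; rewrite !mxE nth_nil mul0rn.
case: m M nzM => [|m] M nzM.
  by case/eqP: nzM; apply/matrixP => i [].
have [g [M' [u [v [eM euv]]]]] := matrix_content M.
have g0 : g != 0 by apply: contraNneq nzM => g0; rewrite eM g0 scale0r.
have {}euv : u *m M' *m v = 1%:M.
  by apply: (scalemx_inj g0); rewrite scalemxAl scalemxAr -eM euv
    scale_scalar_mx mulr1.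
have [V uV eV] : exists2 V, V \in unitmx & V *m delta_mx 0 0 = v.
  exact: (@unimodular_completion _ _ (u *m M')).
have [U uU eU] : exists2 U, U \in unitmx & U *m delta_mx 0 0 = u^T.
  apply: (@unimodular_completion _ _ (M' *m v)^T).
  by rewrite -trmx_mul mulmxA euv trmx1.
pose N : 'M_(1 + p, 1 + m) := U^T *m M' *m V.
have e00 : N 0 0 = 1.
  transitivity ((delta_mx 0 0 *m N *m delta_mx 0 0 : 'M_1) 0 0).
    by rewrite -colE -rowE [RHS]mxE [RHS]mxE.
  rewrite /N !mulmxA -[delta_mx 0 0 *m U^T]trmxK trmx_mul trmxK trmx_delta eU.
  by rewrite trmxK -(mulmxA _ V) eV euv mxE.
have N00 : ulsubmx N = 1%:M.
  rewrite [LHS]mx11_scalar 2!mxE -[RHS]/1%:M -e00; congr _%:M.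
  by congr (N _ _); apply: val_inj.
have [d [sd nzd chd [L [Q [uL uQ eLQ]]]]] :=
  IH m (drsubmx N - dlsubmx N *m ursubmx N).
exists (g :: [seq g * x | x <- d]); split.
- by rewrite /= size_map minnSS ltnS.
- case=> [|i] //=; rewrite size_map ltnS => id.
  by rewrite (nth_map 0) // mulf_neq0 ?nzd.
- case=> [|i]; rewrite /= size_map ltnS => id.
    by rewrite (nth_map 0) //; exists d`_0; rewrite mulrC.
  by rewrite !(nth_map 0) ?(ltnW id) //; apply: rdvdM; [apply: rdvdxx|apply: chd].
(* [X] and [Y] clear the first column and row with the pivot 1 and apply [L] and [Q] to the Schur
   complement. *)
pose X : 'M_(1 + p) := block_mx 1%:M 0 (- (L *m dlsubmx N)) L.
pose Y : 'M_(1 + m) := block_mx 1%:M (- (ursubmx N *m Q)) 0 Q.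
have uX : X \in unitmx by rewrite unitmxE det_lblock det1 mul1r -unitmxE.
have uY : Y \in unitmx by rewrite unitmxE det_ublock det1 mul1r -unitmxE.
have eXY : X *m N *m Y = block_mx 1%:M 0 0 (dmx p m (nth 0 d)).
  rewrite -[N]submxK N00 !mulmx_block !(mul1mx, mulmx1, mul0mx, mulmx0, addr0).
  rewrite !addNr mul0mx add0r -eLQ; congr block_mx.
  by rewrite mulmxBr mulNmx !mulmxA addrC.
exists (X *m U^T), (V *m Y); split.
- by rewrite unitmx_mul unitmx_tr uX.
- by rewrite unitmx_mul uV.
have -> : X *m U^T *m M *m (V *m Y) = g *: (X *m N *m Y).
  by rewrite eM /N -!scalemxAr -!scalemxAl !mulmxA.
rewrite eXY -dmx1 block_dmx scale_dmx; apply: eq_dmx.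
case=> [|k] _ _; rewrite /= ?mulr1 // subSS subn0.
case: (ltnP k (size d)) => kd; first by rewrite (nth_map 0).
by rewrite !nth_default ?size_map // mulr0.
Qed.

End SmithForm.

(** * Coprime matrices and matrix fractions *)

Section Coprimeness.
Variable R : idomainType.
Hypothesis hEDD : elementary_divisor_domain R.
Local Notation F := {fraction R}.
Local Notation toF := (map_mx (@tofrac R)).

Lemma map_tofrac_inj p m : injective (toF : 'M_(p, m) -> 'M[F]_(p, m)).
Proof.
move=> M N /matrixP e; apply/matrixP=> i j; apply/eqP.
by rewrite -tofrac_eq; move: (e i j); rewrite !mxE => ->.
Qed.

(** The Smith form of the stacked matrix exhibits [X *m invmx V] as a common right divisor;
    coprimeness makes it unimodular, so its inverse can be put among the row operations. *)
Lemma right_coprime_completion m q (N1 : 'M[R]_m) (N2 : 'M[R]_(q, m)) :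
  right_coprime_R N1 N2 ->
  exists2 T, T \in unitmx & T *m col_mx N1 N2 = col_mx 1%:M 0.
Proof.
move=> cop; have [d [_ _ _ [U [V [uU uV]]]]] := Smith_form hEDD (col_mx N1 N2).
set X := dmx m m (nth 0 d); rewrite dmx_addm -/X => e.
pose W := invmx U *m col_mx 1%:M 0.
have eW : col_mx N1 N2 = W *m (X *m invmx V).
  rewrite /W -!mulmxA mul_col_mx mul1mx mul0mx.
  have -> : col_mx (X *m invmx V) (0 : 'M_(q, m)) = col_mx X 0 *m invmx V.
    by rewrite mul_col_mx mul0mx.
  by rewrite -e mulmxK // mulKmx.
have uX : X *m invmx V \in unitmx.
  rewrite -[W]vsubmxK mul_col_mx in eW; have [e1 e2] := eq_col_mx eW.
  by apply: cop; [exists (usubmx W) | exists (dsubmx W)].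
exists (block_mx (invmx (X *m invmx V)) 0 0 1%:M *m U).
  by rewrite unitmx_mul uU unitmxE det_ublock det1 mulr1 -unitmxE unitmx_inv uX.
rewrite eW /W -!mulmxA mulKVmx // mulmxA mul_block_col.
by rewrite !mulmx1 !mulmx0 !addr0 mul_col_mx mulVmx // mul0mx.
Qed.

Lemma lcd_multiple p m (T : 'M[F]_(p, m)) s t M N :
  is_lcd t T -> s != 0 -> s%:F *: T = toF M -> t%:F *: T = toF N ->
  exists c, M = c *: N.
Proof.
move=> [_ _ min_t] s0 eM eN; have [c ec] : rdvd t s by apply: min_t; last exists M.
exists c; apply: map_tofrac_inj.
by rewrite -eM ec tofracM map_mxZ -eN scalerA.
Qed.

(** Transfers coprimeness from some least common denominators to given ones: the numerators change
    by scalar factors, so a common right divisor of [N1] and [N2] also divides [M1] and [M2]. *)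
Lemma right_coprime_lcd p q m (T1 : 'M[F]_(p, m)) (T2 : 'M[F]_(q, m)) t1 t2
    N1 N2 :
  right_coprime T1 T2 -> is_lcd t1 T1 -> is_lcd t2 T2 ->
  t1%:F *: T1 = toF N1 -> t2%:F *: T2 = toF N2 ->
  right_coprime_R N1 N2.
Proof.
move=> [s1 [s2 [M1 [M2 [[[s10 _ _] [s20 _ _]] e1 e2 cop]]]]] l1 l2 f1 f2.
have [c1 eM1] := lcd_multiple l1 s10 e1 f1.
have [c2 eM2] := lcd_multiple l2 s20 e2 f2.
move=> E [X eX] [Y eY]; apply: cop.
  by exists (c1 *: X); rewrite eM1 eX scalemxAl.
by exists (c2 *: Y); rewrite eM2 eY scalemxAl.
Qed.

Lemma left_coprime_lcd m p q (T1 : 'M[F]_(m, p)) (T2 : 'M[F]_(m, q)) t1 t2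
    N1 N2 :
  left_coprime T1 T2 -> is_lcd t1 T1 -> is_lcd t2 T2 ->
  t1%:F *: T1 = toF N1 -> t2%:F *: T2 = toF N2 ->
  left_coprime_R N1 N2.
Proof.
move=> [s1 [s2 [M1 [M2 [[[s10 _ _] [s20 _ _]] e1 e2 cop]]]]] l1 l2 f1 f2.
have [c1 eM1] := lcd_multiple l1 s10 e1 f1.
have [c2 eM2] := lcd_multiple l2 s20 e2 f2.
move=> E [X eX] [Y eY]; apply: cop.
  by exists (c1 *: X); rewrite eM1 linearZ /= eX scalemxAl.
by exists (c2 *: Y); rewrite eM2 linearZ /= eY scalemxAl.
Qed.

(* Rosenbrock's reduction of a coprime polynomial system matrix: completing
   [NA NB] to a unimodular matrix turns W = ND - NC NA^-1 NB into a right
   coprime fraction E T^-1 whose numerator and denominator carry the invariant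
   factors of the system matrix and of NA. *)
Lemma coprime_system_fraction n p m (NA : 'M[R]_n) (NB : 'M[R]_(n, m))
    (NC : 'M[R]_(p, n)) (ND : 'M[R]_(p, m)) :
  left_coprime_R NA NB -> right_coprime_R NA NC -> \det NA != 0 ->
  exists (E : 'M[R]_(p, m)) (T : 'M[R]_m),
    [/\ equiv_over_R (block_mx NA NB NC ND) (block_mx 1%:M 0 0 E),
        equiv_over_R (block_mx NA 0 0 1%:M) (block_mx 1%:M 0 0 T),
        exists X Y, X *m E + Y *m T = 1%:M
      & (toF ND - toF NC *m
           invmx (toF NA) *m toF NB)
          *m toF T = toF E].
Proof.
move=> copB copC dA.
have [S0 uS0 eS0] := right_coprime_completion copB.
have [Z uZ eZ] := right_coprime_completion copC.
have [S uS eS] : exists2 S, S \in unitmx & row_mx NA NB *m S = row_mx 1%:M 0.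
  exists S0^T; first by rewrite unitmx_tr.
  apply: trmx_inj.
  by rewrite trmx_mul trmxK tr_row_mx eS0 tr_row_mx trmx1 trmx0.
pose S11 := ulsubmx S; pose S12 := ursubmx S; pose S21 := dlsubmx S.
pose T := drsubmx S.
have sS : S = block_mx S11 S12 S21 T by rewrite submxK.
have [e1 e2] : NA *m S11 + NB *m S21 = 1%:M /\ NA *m S12 + NB *m T = 0.
  by apply: eq_row_mx; rewrite -eS sS mul_row_block.
pose E := NC *m S12 + ND *m T.
have eq1 : block_mx NA NB NC ND *m S = block_mx 1%:M 0 (NC *m S11 + ND *m S21) E.
  by rewrite sS mulmx_block e1 e2.
exists E, T; split.
- exists (block_mx 1%:M 0 (- (NC *m S11 + ND *m S21)) 1%:M), S.
  rewrite unitmxE det_lblock !det1 mulr1 unitr1; split=> //.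
  rewrite -mulmxA eq1 mulmx_block.
  by rewrite !(mul1mx, mulmx1, mul0mx, mulmx0, addr0) addNr add0r.
(* A row operation first turns [NA] + I (direct sum) into the matrix with rows [NA NB] and [0 I], to
   which the same [S] applies. *)
- exists (block_mx 1%:M 0 (- S21) 1%:M *m block_mx 1%:M NB 0 1%:M), S.
  rewrite unitmx_mul !unitmxE det_lblock det_ublock !det1 mulr1 unitr1; split=> //.
  rewrite -!mulmxA [block_mx 1%:M NB _ _ *m _]mulmxA mulmx_block.
  rewrite !(mul1mx, mulmx1, mul0mx, mulmx0, addr0, add0r) sS mulmx_block e1 e2.
  rewrite !(mul1mx, mulmx1, mul0mx, mulmx0, addr0, add0r) mulmx_block.
  by rewrite !(mul1mx, mulmx1, mul0mx, mulmx0, addr0, add0r) addNr.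
- pose X1 := ulsubmx Z; pose X2 := ursubmx Z.
  have eX : X1 *m NA + X2 *m NC = 1%:M.
    have [] : X1 *m NA + X2 *m NC = 1%:M /\ dlsubmx Z *m NA + drsubmx Z *m NC = 0.
      by apply: eq_col_mx; rewrite -mul_block_col submxK.
    by [].
  pose Z1 := dlsubmx (invmx S); pose Z2 := drsubmx (invmx S).
  have eZ1 : Z1 *m S12 + Z2 *m T = 1%:M.
    have : invmx S *m S = block_mx 1%:M 0 0 1%:M.
      by rewrite mulVmx // -scalar_mx_block.
    rewrite -[invmx S]submxK [X in _ *m X = _]sS mulmx_block.
    by case/eq_block_mx.
  exists (Z1 *m X2), (Z2 - Z1 *m (X1 *m NB + X2 *m ND)).
  (* Multiply [S12] by X1 NA + X2 NC = I, then use NA S12 = - NB T and NC S12 = E - ND T.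
     Substituted into Z1 S12 + Z2 T = I, this gives the Bezout identity for [E] and [T]. *)
  have eS12 : S12 = X2 *m E - (X1 *m NB + X2 *m ND) *m T.
    rewrite -[LHS]mul1mx -eX mulmxDl -!mulmxA.
    have -> : NA *m S12 = - (NB *m T) by apply/eqP; rewrite -addr_eq0 e2.
    rewrite /E mulmxDr mulmxDl !mulmxN !mulmxA opprD.
    by rewrite [RHS]addrC addrACA addNr addr0.
  rewrite -[RHS]eZ1 eS12 mulmxBr mulmxBl !mulmxA addrA addrAC.
  by [].
have uA : toF NA \in unitmx by rewrite unitmxE det_map_mx unitfE tofrac_eq0.
have eT : toF NB *m toF T = - (toF NA *m toF S12).
  by apply/eqP; rewrite -addr_eq0 addrC -!map_mxM -map_mxD e2 map_mx0.
rewrite mulmxBl -!mulmxA eT !mulmxN opprK mulKmx //.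
by rewrite /E [RHS]map_mxD !map_mxM addrC.
Qed.

Lemma right_fraction_unique p m (E E' : 'M[R]_(p, m)) (T T' : 'M[R]_m)
    (W : 'M[F]_(p, m)) X Y X' Y' :
  X *m E + Y *m T = 1%:M -> X' *m E' + Y' *m T' = 1%:M ->
  W *m toF T = toF E ->
  W *m toF T' = toF E' ->
  exists2 K, K \in unitmx & E *m K = E' /\ T *m K = T'.
Proof.
set f := toF => eXY eXY' eW eW'.
(* Over the fraction field X1 W + Y1 is the inverse of T1, by the Bezout identity; hence T1^-1 T2 =
   X1 E2 + Y1 T2 has entries in [R]. *)
have key (E1 E2 : 'M_(p, m)) (T1 T2 : 'M_m) X1 Y1 : X1 *m E1 + Y1 *m T1 = 1%:M ->
    W *m toF T1 = toF E1 -> W *m toF T2 = toF E2 ->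
    T1 *m (X1 *m E2 + Y1 *m T2) = T2.
  move=> e w1 w2; apply: map_tofrac_inj.
  rewrite map_mxM map_mxD !map_mxM -w2 mulmxA -mulmxDl mulmxA.
  suff h : (toF X1 *m W + toF Y1) *m toF T1 = 1%:M by rewrite (mulmx1C h) mul1mx.
  by rewrite mulmxDl -mulmxA w1 -!map_mxM -map_mxD e map_mx1.
pose K := X *m E' + Y *m T'; pose K' := X' *m E + Y' *m T.
have eT : T *m K = T' by apply: (key E).
have eT' : T' *m K' = T by apply: (key E').
have eE : E *m K = E'.
  by apply: map_tofrac_inj; rewrite map_mxM -eW -mulmxA -map_mxM eT.
have eE' : E' *m K' = E.
  by apply: map_tofrac_inj; rewrite map_mxM -eW' -mulmxA -map_mxM eT'.
exists K => //.
have : K *m K' = 1%:M by rewrite mulmxDl -!mulmxA eE' eT'.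
by case/mulmx1_unit.
Qed.

End Coprimeness.

(** * Uniqueness of invariant factors through minors *)

Section SmithUniqueness.
Variable R : idomainType.

(** A form of the Cauchy-Binet formula, summed over all maps of row indices instead of subsets; this
    suffices for divisibility. *)
Lemma det_mulmx_rect k p (X : 'M[R]_(k, p)) (Z : 'M[R]_(p, k)) :
  \det (X *m Z) =
  \sum_(f : {ffun 'I_k -> 'I_p}) (\prod_i X i (f i)) * \det (rowsub f Z).
Proof.
pose XZ (s : 'S_k) i j := X i j * Z j (s i).
transitivity (\sum_(f : {ffun 'I_k -> 'I_p}) \sum_(s : 'S_k)
    (-1) ^+ s * \prod_i XZ s i (f i)).
  rewrite exchange_big; apply: eq_bigr => /= s _; rewrite -big_distrr /=.
  congr (_ * _); rewrite -(bigA_distr_bigA (XZ s)) /=.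
  by apply: eq_bigr => x _; rewrite mxE.
apply: eq_bigr => f _; rewrite big_distrr; apply: eq_bigr => s _ /=.
rewrite mulrCA big_split /=; congr (_ * (_ * _)).
by apply: eq_bigr => i _; rewrite mxE.
Qed.

(** Among k + 1 distinct indices one is at least k, and its term is divisible by [f k]; induction
    handles the others. *)
Lemma rdvd_prod_chain (f : nat -> R) (l : seq nat) :
  (forall i, rdvd (f i) (f i.+1)) -> uniq l ->
  rdvd (\prod_(i < size l) f i) (\prod_(x <- l) f x).
Proof.
move=> ch; move e: (size l) => k.
elim: k l e => [|k IH] l e ul; first by
  rewrite big_ord0; exists (\prod_(x <- l) f x); rewrite mulr1.
have [x xl kx] : exists2 x, x \in l & (k <= x)%N.
  have [/hasP[x] |/hasPn h] := boolP (has (leq k) l); first by exists x.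
  have : (size l <= size (iota 0 k))%N.
    by apply: uniq_leq_size => // x /h; rewrite mem_iota -ltnNge.
  by rewrite e size_iota ltnn.
rewrite (perm_big _ (perm_to_rem xl)) /= big_cons big_ord_recr /= mulrC.
apply: rdvdM; first exact: rdvd_chain.
by apply: IH; [rewrite size_rem // e | apply: rem_uniq].
Qed.

Lemma rdvd_minor_dmx k p m (X : 'M[R]_(k, p)) (Y : 'M[R]_(m, k)) (f : nat -> R) :
  (forall i, rdvd (f i) (f i.+1)) ->
  rdvd (\prod_(i < k) f i) (\det (X *m dmx p m f *m Y)).
Proof.
move=> ch; rewrite -mulmxA det_mulmx_rect.
apply: big_ind => [|x y [a ->] [b ->]|g _]; first exact: rdvd0.
  by exists (a + b); rewrite mulrDl.
(* [Y1] is [Y] cut or padded with zero rows to p rows, so that the maps [g] can select rows of it. A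
   non-injective [g] repeats a row and contributes 0. *)
pose Y1 := dmx p m (fun _ => 1) *m Y.
have -> : rowsub g (dmx p m f *m Y) = diag_mx (\row_i f (g i)) *m rowsub g Y1.
  apply/matrixP=> i j; rewrite mul_diag_mx !mxE big_distrr; apply: eq_bigr => l _.
  by rewrite !mxE /= mulrA mulr_natr.
rewrite [\det (diag_mx _ *m _)]det_mulmx det_diag mulrCA.
case: (boolP (injectiveb g)) => [/injectiveP gi|/injectivePn[i1 [i2 ni e]]];
  last first.
  rewrite [\det (rowsub _ _)](determinant_alternate ni) ?mulr0; first exact: rdvd0.
  by move=> j; rewrite !mxE e.
under eq_bigr do rewrite mxE.
rewrite -[\prod_(i < k) f i]mulr1; apply: rdvdM; last first.
  by eexists; rewrite mulr1.
have := @rdvd_prod_chain f [seq val (g i) | i <- enum 'I_k] ch.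
rewrite size_map size_enum_ord big_map big_enum; apply.
by rewrite map_inj_uniq ?enum_uniq // => i j /val_inj /gi.
Qed.

(** The product of the first k terms of [g] is the leading k-minor of [dmx p m g], cut out by
    rectangular identities, hence a minor of the kind treated above. *)
Lemma rdvd_prod_equiv p m k (f g : nat -> R) :
  (forall i, rdvd (f i) (f i.+1)) -> (k <= p)%N -> (k <= m)%N ->
  equiv_over_R (dmx p m f) (dmx p m g) ->
  rdvd (\prod_(i < k) f i) (\prod_(i < k) g i).
Proof.
move=> ch kp km [U [V [_ _ e]]].
have -> : \prod_(i < k) g i =
    \det (dmx k p (fun _ => 1) *m dmx p m g *m dmx m k (fun _ => 1)).
  rewrite !mul_dmx_wide ?geq_min ?kp ?km ?orbT //.
  rewrite dmx_diag det_diag; apply: eq_bigr => i _.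
  by rewrite mxE mul1r mulr1.
rewrite -e mulmxA -(mulmxA _ V) (mulmxA _ U); exact: rdvd_minor_dmx.
Qed.

(** Products of the first k terms divide each other in both directions, so they are associates;
    quotients of consecutive products give the single terms. [K] limits the comparison to nonzero
    terms. *)
Lemma Smith_unique p m K (f g : nat -> R) :
  (forall i, rdvd (f i) (f i.+1)) -> (forall i, rdvd (g i) (g i.+1)) ->
  (K <= p)%N -> (K <= m)%N ->
  (forall i, (i < K)%N -> f i != 0) -> (forall i, (i < K)%N -> g i != 0) ->
  equiv_over_R (dmx p m f) (dmx p m g) ->
  forall i, (i < K)%N -> exists2 u, u \is a GRing.unit & g i = u * f i.
Proof.
move=> chf chg Kp Km f0 g0 e.
have prods k : (k <= K)%N -> exists2 u, u \is a GRing.unit &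
    \prod_(i < k) g i = u * \prod_(i < k) f i.
  move=> kK; apply: rdvd_antisym.
  - by apply: (rdvd_prod_equiv chf _ _ e); apply: leq_trans kK _.
  - by apply: (rdvd_prod_equiv chg _ _ (equiv_over_R_sym e)); apply: leq_trans kK _.
  - by apply/prodf_neq0 => i _; apply: f0; apply: leq_trans kK.
move=> i iK; have [u uu] := prods _ iK; rewrite !big_ord_recr /=.
have [v vu ->] := prods _ (ltnW iK) => h.
exists (u / v); first by rewrite unitrM unitrV uu vu.
have P0 : \prod_(j < i) f j != 0.
  by apply/prodf_neq0 => j _; apply: f0; apply: ltn_trans iK.
apply: (mulfI P0); apply: (mulrI vu); rewrite mulrA h.
rewrite -[LHS]mul1r -(mulrV vu); move: (v^-1) => w; ring.
Qed.

End SmithUniqueness.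

(** * Ranks and Schur complements over a field *)

Section FieldMatrices.
Variable K : fieldType.

Lemma mxrank_unit_equiv p m (H : 'M[K]_(p, m)) (U : 'M[K]_p) (V : 'M[K]_m) :
  U \in unitmx -> V \in unitmx -> \rank (U *m H *m V) = \rank H.
Proof.
by move=> uU uV; rewrite mxrankMfree ?row_free_unit // eqmxMfull ?row_full_unit.
Qed.

Lemma rank_dmx p m r (h : nat -> K) : (r <= p)%N -> (r <= m)%N ->
  (forall i, (i < r)%N -> h i != 0) -> (forall i, (r <= i)%N -> h i = 0) ->
  \rank (dmx p m h) = r.
Proof.
move=> rp rm h0 h1.
pose u := dmx p p (fun i => if (i < r)%N then h i else 1).
have uu : u \in unitmx.
  rewrite unitmxE /u dmx_diag det_diag unitfE; apply/prodf_neq0 => i _.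
  by rewrite mxE; case: ifP => [/h0 //|]; rewrite oner_neq0.
have -> : dmx p m h = u *m dmx p m (fun i => (i < r)%N%:R).
  rewrite mul_dmx_wide ?geq_minl //; apply: eq_dmx => i _ _.
  by case: ltnP => ir; rewrite ?mulr1 // mulr0 h1.
have -> : dmx p m (fun i => (i < r)%N%:R) = pid_mx r :> 'M[K]_(p, m).
  by apply/matrixP=> i j; rewrite !mxE -mulrnA mulnb andbC.
by rewrite eqmxMfull ?row_full_unit // rank_pid_mx.
Qed.

(** Both D and C A^-1 B pick up the same factor b c / a under the scaling. *)
Lemma scaled_schur_complement n p m (A : 'M[K]_n) (B : 'M[K]_(n, m))
    (C : 'M[K]_(p, n)) (D : 'M[K]_(p, m)) a b c :
  A \in unitmx -> a != 0 -> b != 0 -> c != 0 ->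
  D - C *m invmx A *m B =
  (a / (b * c)) *: ((b * c / a) *: D -
                    (c *: C) *m invmx (a *: A) *m (b *: B)).
Proof.
move=> uA a0 b0 c0; have uaA : a *: A \in unitmx by rewrite unitmxZ ?unitfE.
rewrite scalerBr invmxZ // -!scalemxAr -!scalemxAl !scalerA.
have -> : a / (b * c) * (b * c / a) = 1 by field; rewrite a0 b0 c0.
have -> : a / (b * c) * (b / a * c) = 1 by field; rewrite a0 b0 c0.
by rewrite !scale1r.
Qed.

End FieldMatrices.

(** * Smith-McMillan forms and Smith forms of scaled matrices *)

Section SmithMcMillan.
Variable R : idomainType.
Hypothesis hEDD : elementary_divisor_domain R.
Local Notation F := {fraction R}.
Local Notation toF := (map_mx (@tofrac R)).

(** Finite choice by induction: witnesses of finitely many existence statements are collected in a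
    sequence. *)
Lemma seq_choice (T : Type) (x0 : T) (P : nat -> T -> Prop) r :
  (forall i, (i < r)%N -> exists x, P i x) ->
  exists2 s, size s = r & forall i, (i < r)%N -> P i (nth x0 s i).
Proof.
elim: r => [|r IH] h; first by exists [::].
have [i ir|s ss hs] := IH; first by apply: h; apply: ltnW.
have [x Px] := h r (ltnSn r); exists (rcons s x); first by rewrite size_rcons ss.
move=> i; rewrite ltnS leq_eqVlt nth_rcons ss => /predU1P[->|ir].
  by rewrite ltnn eqxx.
by rewrite ir; apply: hs.
Qed.

Lemma map_dmx p m (f : nat -> R) : toF (dmx p m f) = dmx p m (fun i => (f i)%:F).
Proof. by apply/matrixP=> i j; rewrite !mxE rmorphMn. Qed.

Lemma diag_fracE p m (e f : seq R) :
  diag_frac p m e f = dmx p m (fun i => (nth 0 e i)%:F / (nth 1 f i)%:F).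
Proof. by []. Qed.

Lemma map_tofrac_unit n (U : 'M[R]_n) : U \in unitmx -> toF U \in unitmx.
Proof. by rewrite !unitmxE det_map_mx; apply: rmorph_unit. Qed.

Lemma equiv_over_R_rank p m (M N : 'M[R]_(p, m)) :
  equiv_over_R M N -> \rank (toF M) = \rank (toF N).
Proof.
move=> [U [V [uU uV <-]]].
by rewrite !map_mxM mxrank_unit_equiv ?map_tofrac_unit.
Qed.

Lemma rank_map_dmx_seq p m (d : seq R) : (size d <= p)%N -> (size d <= m)%N ->
  (forall i, (i < size d)%N -> d`_i != 0) ->
  \rank (toF (dmx p m (nth 0 d))) = size d.
Proof.
move=> dp dm d0; rewrite map_dmx; apply: rank_dmx => // i id.
  by rewrite tofrac_eq0 d0.
by rewrite nth_default // tofrac0.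
Qed.

(** Take the Smith form of t W and reduce each d_i / t to lowest terms; the chain of the d_i then
    gives both chains of the reduced fractions. *)
Lemma Smith_McMillan_exists p m (W : 'M[F]_(p, m)) (t : R) (N : 'M[R]_(p, m)) :
  t != 0 -> t%:F *: W = toF N -> exists e f, smith_mcmillan_form W e f.
Proof.
move=> t0 eW; have [d [sd d0 chd [U [V [uU uV eN]]]]] := Smith_form hEDD N.
have [dp dm] : (size d <= p /\ size d <= m)%N by move: sd; rewrite leq_min => /andP.
have [i id|s ss hs] := @seq_choice _ (0, 0)
  (fun i x => [/\ comaximal x.1 x.2, x.2 != 0 & d`_i * x.2 = t * x.1]) (size d).
  have [g [u [v [a [b [ea eb e]]]]]] := EDD_bezout hEDD d`_i t.
  exists (a, b); split=> /=; first by exists u, v.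
    by apply: contraNneq t0 => b0; rewrite eb b0 mul0r.
  by rewrite ea eb; ring.
pose e := unzip1 s; pose f := unzip2 s.
have se : size e = size d by rewrite size_map.
have sf : size f = size d by rewrite size_map.
have hef i : (i < size d)%N ->
    [/\ comaximal e`_i f`_i, f`_i != 0 & d`_i * f`_i = t * e`_i].
  by move=> id; rewrite /e /f !(nth_map (0, 0)) ?ss //; apply: hs.
have t0F : t%:F != 0 by rewrite tofrac_eq0.
have eqW : toF U *m W *m toF V = diag_frac p m e f.
  apply: (scalemx_inj t0F); rewrite scalemxAl scalemxAr eW -!map_mxM eN map_dmx.
  rewrite diag_fracE scale_dmx; apply: eq_dmx => i _ _.
  case: (ltnP i (size d)) => id; last first.
    by rewrite !nth_default ?se ?sf // mul0r mulr0.
  have [_ f0 h] := hef _ id; rewrite (set_nth_default 0) ?sf // mulrA -tofracM -h.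
  by rewrite tofracM mulfK // tofrac_eq0.
have rW : \rank W = size d.
  rewrite -(mxrank_unit_equiv _ (map_tofrac_unit uU) (map_tofrac_unit uV)).
  rewrite -(mxrank_scale_nz _ t0F) scalemxAl scalemxAr eW -!map_mxM eN.
  exact: rank_map_dmx_seq.
have e0 i : (i < size d)%N -> e`_i != 0.
  move=> id; have [_ f0 h] := hef _ id.
  by apply: contraTneq (mulf_neq0 (d0 _ id) f0) => e0; rewrite h e0 mulr0 eqxx.
exists e, f; rewrite /smith_mcmillan_form rW; split=> //; last by exists U, V.
- by move=> i id; have [_ ? _] := hef _ id; split=> //; apply: e0.
- move=> i id; have [c1 f1 h1] := hef _ (ltnW id); have [c2 f2 h2] := hef _ id.
  have [x ex] := chd _ id; apply: (@lowest_terms_chain _ _ _ _ _ x) => //.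
  apply: (mulfI t0); rewrite mulrA -h2 ex -!mulrA [f`_i.+1 * _]mulrC !mulrA.
  by rewrite -(mulrA x) h1; ring.
- by move=> i id; apply: comaximal_is_gcd; have [] := hef _ id.
Qed.

(** The values d_i = t e_i / f_i are invariant factors of t H; they lie in [R] because they are
    diagonal entries of U N V. *)
Lemma smith_mcmillan_scaled p m (H : 'M[F]_(p, m)) (e f : seq R) (t : R)
    (N : 'M[R]_(p, m)) :
  smith_mcmillan_form H e f -> t != 0 -> t%:F *: H = toF N ->
  exists d : seq R,
    [/\ size d = size e, forall i, (i < size d)%N -> d`_i != 0,
        forall i, (i < size d)%N -> t * e`_i = d`_i * f`_i,
        forall i, (i.+1 < size d)%N -> rdvd d`_i d`_i.+1
      & equiv_over_R N (dmx p m (nth 0 d))].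
Proof.
move=> [[se sf] ef0 chef _ [U [V [uU uV eH]]]] t0 eN.
have eUV : toF (U *m N *m V) =
    dmx p m (fun i => t%:F * ((nth 0 e i)%:F / (nth 1 f i)%:F)).
  by rewrite !map_mxM -eN -scalemxAr -scalemxAl eH diag_fracE scale_dmx.
have [i ie|d sd hd] := @seq_choice R 0 (fun i x => t * e`_i = x * f`_i) (size e).
  have ir : (i < \rank H)%N by rewrite -se.
  have ip := leq_trans ir (rank_leq_row H).
  have im := leq_trans ir (rank_leq_col H).
  exists ((U *m N *m V) (Ordinal ip) (Ordinal im)).
  have [_ f0] := ef0 _ ir.
  have h : ((U *m N *m V) (Ordinal ip) (Ordinal im))%:F =
      t%:F * ((e`_i)%:F / (f`_i)%:F).
    transitivity (toF (U *m N *m V) (Ordinal ip) (Ordinal im)).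
      by rewrite [RHS]mxE.
    rewrite eUV mxE /= eqxx.
    by rewrite (set_nth_default 0 1) // sf.
  apply/eqP; rewrite -tofrac_eq !tofracM h mulrA divfK //.
  by rewrite tofrac_eq0.
have hd0 i : (i < size d)%N -> d`_i != 0.
  rewrite sd => id; have [e0 _] : e`_i != 0 /\ f`_i != 0 by apply: ef0; rewrite -se.
  by apply: contraTneq (mulf_neq0 t0 e0) => h; rewrite hd // h mul0r eqxx.
exists d; split=> // [i id|i id|].
- by apply: hd; rewrite -sd.
- rewrite sd in id.
  have [ce cf] : rdvd e`_i e`_i.+1 /\ rdvd f`_i.+1 f`_i.
    by apply: chef; rewrite -se.
  have [_ f0] : e`_i != 0 /\ f`_i != 0 by apply: ef0; rewrite -se ltnW.
  by apply: (rdvd_scaled_chain f0 ce cf); apply: hd; rewrite // ltnW.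
exists U, V; split=> //; apply: map_tofrac_inj; rewrite eUV map_dmx.
apply: eq_dmx => i _ _; case: (ltnP i (size e)) => ie; last first.
  by rewrite [in LHS]nth_default // [in RHS]nth_default ?sd // tofrac0 mul0r mulr0.
have [_ f0] : e`_i != 0 /\ f`_i != 0 by apply: ef0; rewrite -se.
rewrite (set_nth_default 0) ?sf -?se // mulrA -tofracM hd // tofracM mulfK //.
by rewrite tofrac_eq0.
Qed.

End SmithMcMillan.

(** * The transfer function of a coprime system over the ring *)

Section TransferFunction.
Variable R : idomainType.
Hypothesis hEDD : elementary_divisor_domain R.
Local Notation F := {fraction R}.
Local Notation toF := (map_mx (@tofrac R)).

Lemma rdvd_chain_nseq1 k (s : seq R) : (forall i, rdvd s`_i s`_i.+1) ->
  forall i, rdvd (nth 0 (nseq k 1 ++ s) i) (nth 0 (nseq k 1 ++ s) i.+1).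
Proof.
move=> ch; elim: k => [//|k IH] [|i]; last exact: IH.
by eexists; rewrite mulr1.
Qed.

Lemma nth_nseq1_cat_neq0 k (s : seq R) :
  (forall i, (i < size s)%N -> s`_i != 0) ->
  forall i, (i < k + size s)%N -> (nseq k 1 ++ s)`_i != 0.
Proof.
move=> s0 i ik; rewrite nth_cat size_nseq nth_nseq.
case: ltnP => [_|ki]; first exact: oner_neq0.
by apply: s0; rewrite -(ltn_add2l k) subnKC.
Qed.

Lemma dmx_nseq1_cat n p m (s : seq R) :
  block_mx 1%:M 0 0 (dmx p m (nth 0 s)) =
  dmx (n + p) (n + m) (nth 0 (nseq n 1 ++ s)).
Proof.
rewrite -dmx1 block_dmx; apply: eq_dmx => i _ _.
by rewrite nth_cat size_nseq nth_nseq; case: ifP.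
Qed.

Lemma dmx_cat_nseq1 n m (s : seq R) : size s = n ->
  block_mx (dmx n n (nth 0 s)) 0 0 1%:M =
  dmx (n + m) (n + m) (nth 0 (s ++ nseq m 1)).
Proof.
move=> ss; rewrite -dmx1 block_dmx; apply: eq_dmx => i im _.
rewrite nth_cat ss nth_nseq; case: ltnP => // ni.
by rewrite -(ltn_add2l n) subnKC // im.
Qed.

(** Read from its end, the padded list is [rev s] continued by ones, which the default 1
    expresses. *)
Lemma nth_nseq1_cat_rev k (s : seq R) i : (i < k + size s)%N ->
  nth 0 (nseq k 1 ++ s) (k + size s - i.+1) = nth 1 (rev s) i.
Proof.
move=> ik; have sz : size (nseq k 1 ++ s) = (k + size s)%N.
  by rewrite size_cat size_nseq.
rewrite -sz -nth_rev ?sz // rev_cat rev_nseq nth_cat size_rev.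
rewrite nth_nseq; case: ltnP => si.
  by apply: set_nth_default; rewrite size_rev.
by rewrite nth_default ?size_rev // -(ltn_add2r (size s)) subnK // ik.
Qed.

(** The result for [W] before rescaling. The fractions need not be in lowest terms, and the default
    1 of [nth] supplies the denominators with index i >= n. *)
Theorem transfer_function_Smith_McMillan n p m (NA : 'M[R]_n) (NB : 'M[R]_(n, m))
    (NC : 'M[R]_(p, n)) (ND : 'M[R]_(p, m)) (a d : seq R) r :
  (r <= p)%N -> (r <= m)%N ->
  left_coprime_R NA NB -> right_coprime_R NA NC -> \det NA != 0 ->
  size a = n -> (forall i, (i < n)%N -> a`_i != 0) ->
  (forall i, (i.+1 < n)%N -> rdvd a`_i a`_i.+1) ->
  equiv_over_R NA (dmx n n (nth 0 a)) ->
  size d = (n + r)%N -> (forall i, (i < n + r)%N -> d`_i != 0) ->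
  (forall i, (i.+1 < n + r)%N -> rdvd d`_i d`_i.+1) ->
  equiv_over_R (block_mx NA NB NC ND) (dmx (n + p) (n + m) (nth 0 d)) ->
  let W := toF ND - toF NC *m invmx (toF NA) *m toF NB in
  [/\ \rank W = r
    & equivalent_mx W (dmx p m (fun i => (d`_(n + i))%:F / (nth 1 (rev a) i)%:F))].
Proof.
move=> rp rm copB copC dA sa a0 cha eA sd d0 chd eQ W.
have [E [T [eqQ eqA [X [Y eXY]] eW]]] :=
  coprime_system_fraction hEDD ND copB copC dA.
rewrite -/W in eW.
have dT : \det T != 0.
  have [U [V [_ _ /(congr1 determinant)]]] := equiv_over_R_sym eqA.
  rewrite !det_mulmx !det_ublock !det1 mul1r mulr1 => e.
  by apply: contraNneq dA => t0; rewrite -e t0 mulr0 mul0r.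
have rW : \rank W = \rank (toF E).
  by rewrite -eW mxrankMfree // row_free_unit unitmxE det_map_mx unitfE tofrac_eq0.
have [e [f hW]] : exists e f, smith_mcmillan_form W e f.
  (* The determinant of [NA] is a denominator of [W], by the adjugate formula for the inverse. *)
  apply: (Smith_McMillan_exists hEDD dA (N := \det NA *: ND - NC *m \adj NA *m NB)).
  rewrite scalerBr map_mxB map_mxZ !map_mxM map_mx_adj; congr (_ - _).
  rewrite scalemxAl scalemxAr; congr (_ *m _ *m _).
  rewrite /invmx unitmxE det_map_mx unitfE tofrac_eq0 dA scalerA divrr ?scale1r //.
  by rewrite unitfE tofrac_eq0.
have [[se sf] ef0 chef copef [U [V [uU uV eqW]]]] := hW.
set k := \rank W in se sf ef0 chef copef.
have kp : (k <= p)%N := rank_leq_row W.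
have km : (k <= m)%N := rank_leq_col W.
(* The default 1 completes [Psi] to a nonsingular square matrix, and the default 0 ends the
   numerator [E2] after the k terms of [e]. *)
pose Psi := dmx m m (nth 1 f); pose E2 := dmx p m (nth 0 e).
have f1 i : nth 1 f i != 0.
  case: (ltnP i k) => ik; last by rewrite nth_default ?sf // oner_neq0.
  by rewrite (set_nth_default 0) ?sf //; have [] := ef0 _ ik.
(* Bezout coefficients for each reduced fraction; the default (0, 1) fits the terms 0 and 1 beyond
   k. *)
have [xy sxy hxy] : exists2 s : seq (R * R), size s = k &
    forall i, (i < k)%N ->
      (nth (0, 1) s i).1 * e`_i + (nth (0, 1) s i).2 * f`_i = 1.
  apply: (@seq_choice _ (0, 1) (fun i x => x.1 * e`_i + x.2 * f`_i = 1)) => i ik.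
  by have [u [v h]] := is_gcd1_comaximal hEDD (copef _ ik); exists (u, v).
have eXY2 : dmx m p (fun i => (nth (0, 1) xy i).1) *m E2 +
    dmx m m (fun i => (nth (0, 1) xy i).2) *m Psi = 1%:M.
  rewrite mul_dmx => [|i /andP[pi _]]; last first.
    by rewrite [e`_i]nth_default ?mulr0 // se (leq_trans kp).
  rewrite mul_dmx_wide ?geq_minl // add_dmx -dmx1; apply: eq_dmx => i _ _.
  case: (ltnP i k) => ik; first by rewrite (set_nth_default 0 1) ?sf // hxy.
  by rewrite !nth_default ?sf ?se ?sxy //= mulr0 mulr1 add0r.
have eW2 : toF U *m W *m toF V *m toF Psi = toF E2.
  rewrite eqW diag_fracE !map_dmx mul_dmx_wide ?geq_minr //; apply: eq_dmx => i _ _.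
  by rewrite divfK // tofrac_eq0.
have eW1 : toF U *m W *m toF V *m toF (invmx V *m T) = toF (U *m E).
  rewrite !map_mxM -eW -!mulmxA; congr (_ *m (_ *m _)).
  by rewrite mulmxA -map_mxM mulmxV // map_mx1 mul1mx.
have eXY1 : (X *m invmx U) *m (U *m E) + (Y *m V) *m (invmx V *m T) = 1%:M.
  by rewrite -!mulmxA mulKmx // mulKVmx.
(* [U E] over [invmx V *m T] and [E2] over [Psi] are two right coprime fractions of U W V, so they
   differ by a unimodular factor. *)
have [K uK [eE2 eT2]] := right_fraction_unique eXY1 eXY2 eW1 eW2.
have equivE : equiv_over_R E E2 by exists U, K.
have equivT : equiv_over_R T Psi by exists (invmx V), K; rewrite unitmx_inv.
have chd' := rdvd_chain_nth (s := d); rewrite sd in chd'.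
have {}chd' := chd' chd.
have che : forall i, rdvd e`_i e`_i.+1.
  by apply: rdvd_chain_nth; rewrite se => i /chef [].
have equivQ : equiv_over_R (dmx (n + p) (n + m) (nth 0 d))
    (dmx (n + p) (n + m) (nth 0 (nseq n 1 ++ e))).
  rewrite -dmx_nseq1_cat; apply: (equiv_over_R_trans (equiv_over_R_sym eQ)).
  exact: equiv_over_R_trans eqQ (equiv_over_R_diag _ equivE).
have nz1e i : (i < n + k)%N -> (nseq n 1 ++ e)`_i != 0.
  by rewrite -se; apply: nth_nseq1_cat_neq0 => l; rewrite se => /ef0[].
(* The system matrix has rank n + r by its Smith form and n + k by the fraction. *)
have kr : k = r.
  have := equiv_over_R_rank equivQ.
  rewrite !rank_map_dmx_seq ?size_cat ?size_nseq ?sd ?se ?leq_add2l //.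
  by move/addnI.
rewrite -/k kr; split=> //.
have numer i : (i < r)%N -> exists2 u, u \is a GRing.unit & e`_i = u * d`_(n + i).
  move=> ir.
  have [u uu h] : exists2 u, u \is a GRing.unit &
      (nseq n 1 ++ e)`_(n + i) = u * d`_(n + i).
    rewrite kr in nz1e.
    by apply: (Smith_unique (K := n + r) chd' (rdvd_chain_nseq1 n che) _ _ d0
                 nz1e equivQ);
      rewrite ?leq_add2l ?ltn_add2l.
  by exists u; rewrite // -h nth_cat size_nseq ltnNge leq_addr addKn.
have chf i : rdvd (rev f)`_i (rev f)`_i.+1.
  move: i; apply: rdvd_chain_nth => i; rewrite size_rev sf => ik.
  rewrite !nth_rev ?sf // ?(ltnW ik) //.
  have e1 : (k - i.+1 = (k - i.+2).+1)%N by rewrite subnSK.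
  by rewrite e1; apply: (chef _ _).2; rewrite -e1 ltn_subrL /= (leq_ltn_trans _ ik).
have cha' : forall i, rdvd a`_i a`_i.+1.
  by apply: rdvd_chain_nth; rewrite sa.
(* The chain is [NA] + I, I + [T], I + [Psi] (direct sums). Units are moved to the front and [f] is
   reversed so that both diagonals become increasing divisibility chains. *)
have equivD : equiv_over_R (dmx (n + m) (n + m) (nth 0 (nseq m 1 ++ a)))
    (dmx (n + m) (n + m) (nth 0 (nseq (n + (m - k)) 1 ++ rev f))).
  have ePsi : Psi = dmx m m (nth 0 (f ++ nseq (m - k) 1)).
    apply: eq_dmx => i im _; rewrite nth_cat sf nth_nseq; case: ltnP => ik.
      by apply: set_nth_default; rewrite sf.
    by rewrite nth_default ?sf // ltn_sub2rE // im.
  apply: (@equiv_over_R_trans _ _ _ (dmx (n + m) (n + m) (nth 0 (a ++ nseq m 1)))).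
    apply: equiv_dmx_perm; last by rewrite perm_catC.
    by rewrite size_cat size_nseq sa addnC.
  rewrite -dmx_cat_nseq1 //.
  apply: (equiv_over_R_trans (equiv_over_R_diagl m (equiv_over_R_sym eA))).
  apply: (equiv_over_R_trans eqA).
  apply: (equiv_over_R_trans (equiv_over_R_diag n equivT)).
  rewrite ePsi dmx_nseq1_cat; apply: equiv_dmx_perm.
    by rewrite !size_cat !size_nseq sf subnKC.
  rewrite nseqD -catA perm_cat2l perm_catC perm_cat2l perm_sym.
  by rewrite perm_rev.
have rev_a0 i : nth 1 (rev a) i != 0.
  case: (ltnP i n) => ni; last by rewrite nth_default ?size_rev ?sa // oner_neq0.
  rewrite (set_nth_default 0) ?size_rev ?sa // nth_rev ?sa // a0 //.
  by rewrite ltn_subrL /= (leq_ltn_trans _ ni).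
have denom i : (i < r)%N ->
    exists2 u, u \is a GRing.unit & f`_i = u * nth 1 (rev a) i.
  rewrite -kr => ik; have inm : (i < n + m)%N by rewrite ltn_addl // (leq_trans ik).
  have snm : (n + (m - k) + size (rev f) = n + m)%N.
    by rewrite size_rev sf -addnA subnK.
  (* Position n + m - i - 1 is the i-th from the end: it carries [f] at i on one side and the i-th
     term of [rev a] on the other. *)
  have [u uu h] : exists2 u, u \is a GRing.unit &
      nth 0 (nseq (n + (m - k)) 1 ++ rev f) (n + m - i.+1) =
      u * nth 0 (nseq m 1 ++ a) (n + m - i.+1).
    apply: (Smith_unique (K := n + m) (rdvd_chain_nseq1 m cha')
             (rdvd_chain_nseq1 _ chf) _ _ _ _ equivD) => // [j jnm|j jnm|].
    - apply: nth_nseq1_cat_neq0; last by rewrite sa addnC.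
      by move=> l; rewrite sa; apply: a0.
    - apply: nth_nseq1_cat_neq0; last by rewrite snm.
      move=> l; rewrite size_rev => lf; rewrite nth_rev // sf.
      have [] // := ef0 (k - l.+1)%N.
      by rewrite ltn_subrL /= -sf (leq_ltn_trans _ lf).
    - by rewrite ltn_subrL /= (leq_ltn_trans _ inm).
  exists u => //; rewrite -(nth_nseq1_cat_rev (k := m)) ?sa 1?addnC // -h.
  rewrite -snm nth_nseq1_cat_rev ?snm // revK.
  by rewrite (set_nth_default 0) ?sf.
(* The units [w] compensate those relating e_i / f_i to the wanted fractions; they are absorbed into
   [V]. *)
have [i ir|w sw hw] := @seq_choice R 1 (fun i w => w \is a GRing.unit /\
    e`_i * w * nth 1 (rev a) i = d`_(n + i) * f`_i) r.
  have [u uu ->] := numer _ ir; have [v uv ->] := denom _ ir.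
  exists (v / u); rewrite unitrM uv unitrV uu; split=> //.
  rewrite -[RHS]mul1r -(mulrV uu); move: (u^-1) => u'; ring.
exists U, (V *m dmx m m (nth 1 w)); split=> //.
  rewrite unitmx_mul uV unitmxE dmx_diag det_diag rpred_prod // => i _.
  rewrite mxE; case: (ltnP i r) => ir; last by rewrite nth_default ?sw ?unitr1.
  by have [] := hw _ ir.
rewrite map_mxM mulmxA eqW diag_fracE map_dmx mul_dmx_wide ?geq_minr //.
apply: eq_dmx => i _ _; case: (ltnP i r) => ir; last first.
  rewrite [e`_i]nth_default ?se ?kr // [d`_(_)]nth_default ?sd ?leq_add2l //.
  by rewrite tofrac0 !mul0r.
have [_ h] := hw _ ir.
apply/eqP; rewrite mulrAC eqr_div ?tofrac_eq0 // -!tofracM tofrac_eq.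
by rewrite h (set_nth_default 0 1) ?sf ?kr.
Qed.

End TransferFunction.

(** * Return to the fraction field and reduction to lowest terms *)

(* Indices are 0-based: mu i is mu_{i+1}, at_ i is alpha~_{n-i}, and so on.
   If r > n, the terms alpha_{n-i}, beta_{n-i} with i >= n are read as alpha
   and 1, i.e. the list of invariant factors alpha * beta_j / alpha_j of
   alpha * A is continued by 1's; for r <= n the padding is never used. *)
Theorem theorem6p5 (R : idomainType)
  (hEDD : elementary_divisor_domain R) (hnf : not_a_field R)
  (n m p : nat)
  (A : 'M[{fraction R}]_n) (B : 'M[{fraction R}]_(n, m))
  (C : 'M[{fraction R}]_(p, n)) (D : 'M[{fraction R}]_(p, m))
  (hA : \det A != 0)
  (hAB : left_coprime A B) (hAC : right_coprime A C)
  (alpha beta gamma : R)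
  (halpha : is_lcd alpha A) (hbeta : is_lcd beta B) (hgamma : is_lcd gamma C)
  (hD : over_R ((beta%:F * gamma%:F / alpha%:F) *: D))
  (P : 'M[{fraction R}]_(n + p, n + m))
  (hP : P = (beta%:F * gamma%:F)^-1 *:
              block_mx (alpha%:F *: A) (beta%:F *: B)
                       (gamma%:F *: C)
                       ((beta%:F * gamma%:F / alpha%:F) *: D))
  (r : nat) (hr : r = (\rank P - n)%N)
  (nu delta : r.-tuple R)
  (hSP : smith_mcmillan_form P
           (nseq n 1 ++ nu) (nseq n (beta * gamma) ++ delta))
  (alphas betas : n.-tuple R)
  (hSA : smith_mcmillan_form A betas alphas)
  (mu sigma at_ bt_ dt_ nt_ : 'I_r -> R)
  (hmu : forall i : 'I_r,
     is_gcd (mu i) (from_end alpha alphas i) (tnth delta i))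
  (hat : forall i : 'I_r, from_end alpha alphas i = at_ i * mu i)
  (hdt : forall i : 'I_r, tnth delta i = dt_ i * mu i)
  (hsigma : forall i : 'I_r,
     is_gcd (sigma i) (from_end 1 betas i) (tnth nu i))
  (hbt : forall i : 'I_r, from_end 1 betas i = bt_ i * sigma i)
  (hnt : forall i : 'I_r, tnth nu i = nt_ i * sigma i) :
  smith_mcmillan_form (D - C *m invmx A *m B)
    (codom (fun i : 'I_r => at_ i * nt_ i))
    (codom (fun i : 'I_r => bt_ i * dt_ i)).
Proof.
have [alpha0 [NA eNA] _] := halpha; have [beta0 [NB eNB] _] := hbeta.
have [gamma0 [NC eNC] _] := hgamma; have [ND eND] := hD.
have bg0 : beta * gamma != 0 by rewrite mulf_neq0.
have aF0 : alpha%:F != 0 by rewrite tofrac_eq0.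
have bF0 : beta%:F != 0 by rewrite tofrac_eq0.
have gF0 : gamma%:F != 0 by rewrite tofrac_eq0.
have copB := left_coprime_lcd hAB halpha hbeta eNA eNB.
have copC := right_coprime_lcd hAC halpha hgamma eNA eNC.
have dNA : \det NA != 0.
  by rewrite -tofrac_eq0 -det_map_mx -eNA detZ mulf_neq0 ?expf_neq0.
have eQ : (beta * gamma)%:F *: P = map_mx (@tofrac R) (block_mx NA NB NC ND).
  rewrite hP scalerA tofracM divff ?mulf_neq0 // scale1r map_block_mx.
  by rewrite -eNA -eNB -eNC -eND.
(* The length of the displayed list fixes the rank, so the natural subtraction defining [r] is not
   truncated. *)
have rP : \rank P = (n + r)%N.
  by have [[<- _] _ _ _ _] := hSP; rewrite size_cat size_nseq size_tuple.
have rA : \rank A = n by have [[<- _] _ _ _ _] := hSA; rewrite size_tuple.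
have rp : (r <= p)%N by rewrite -(leq_add2l n) -rP rank_leq_row.
have rm : (r <= m)%N by rewrite -(leq_add2l n) -rP rank_leq_col.
have [a [sa a0 ea cha eqA]] := smith_mcmillan_scaled hSA alpha0 eNA.
have [d [sd d0 ed chd eqQ]] := smith_mcmillan_scaled hSP bg0 eQ.
rewrite size_tuple in sa; rewrite sa in a0 ea cha.
rewrite size_cat size_nseq size_tuple in sd; rewrite sd in d0 ed chd.
have [] := transfer_function_Smith_McMillan hEDD rp rm copB copC dNA sa a0 cha eqA
  sd d0 chd eqQ.
set W := (X in \rank X) => rW [U [V [uU uV eqW]]].
have eG : D - C *m invmx A *m B = (alpha%:F / (beta%:F * gamma%:F)) *: W.
  have uA : A \in unitmx by rewrite unitmxE unitfE.
  by rewrite (scaled_schur_complement B C D uA aF0 bF0 gF0) eNA eNB eNC eND.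
have c0 : alpha%:F / (beta%:F * gamma%:F) != 0.
  by rewrite mulf_neq0 ?invr_neq0 ?mulf_neq0.
have rG : \rank (D - C *m invmx A *m B) = r by rewrite eG mxrank_scale_nz.
have [_ hSA0 _ hSAco _] := hSA; have [_ hSP0 _ hSPco _] := hSP.
rewrite rA in hSA0 hSAco; rewrite rP in hSP0 hSPco.
pose av := from_end alpha alphas; pose bv := from_end 1 betas.
pose a' := nth 1 (rev a).
have rev_lt i : (i < n)%N -> (n - i.+1 < n)%N.
  by move=> ni; rewrite ltn_subrL /= (leq_ltn_trans _ ni).
have av_lt i : (i < n)%N -> av i = alphas`_(n - i.+1).
  move=> ni; rewrite /av /from_end (set_nth_default 0) ?size_rev ?size_tuple //.
  by rewrite nth_rev ?size_tuple.
have bv_lt i : (i < n)%N -> bv i = betas`_(n - i.+1).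
  move=> ni; rewrite /bv /from_end (set_nth_default 0) ?size_rev ?size_tuple //.
  by rewrite nth_rev ?size_tuple.
have a'_lt i : (i < n)%N -> a' i = a`_(n - i.+1).
  move=> ni; rewrite /a' (set_nth_default 0) ?size_rev ?sa //.
  by rewrite nth_rev ?sa.
have av_ge i : (n <= i)%N -> av i = alpha.
  by move=> ni; rewrite /av /from_end nth_default // size_rev size_tuple.
have bv_ge i : (n <= i)%N -> bv i = 1.
  by move=> ni; rewrite /bv /from_end nth_default // size_rev size_tuple.
have a'_ge i : (n <= i)%N -> a' i = 1.
  by move=> ni; rewrite /a' nth_default // size_rev sa.
have av0 i : av i != 0.
  case: (ltnP i n) => ni; last by rewrite av_ge.
  by rewrite av_lt //; have [] := hSA0 _ (rev_lt _ ni).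
have bv0 i : bv i != 0.
  case: (ltnP i n) => ni; last by rewrite bv_ge // oner_neq0.
  by rewrite bv_lt //; have [] := hSA0 _ (rev_lt _ ni).
have a'0 i : a' i != 0.
  case: (ltnP i n) => ni; last by rewrite a'_ge // oner_neq0.
  by rewrite a'_lt // a0 ?rev_lt.
(* This is a_j = alpha beta_j / alpha_j cross-multiplied; beyond n it reads alpha 1 = 1 alpha,
   consistent with the padding. *)
have avbv i : alpha * bv i = a' i * av i.
  case: (ltnP i n) => ni; last by rewrite bv_ge // a'_ge // av_ge // mulrC.
  by rewrite bv_lt // a'_lt // av_lt // ea ?rev_lt.
have co_bv_av i : comaximal (bv i) (av i).
  case: (ltnP i n) => ni; last first.
    by rewrite bv_ge //; exists 1, 0; rewrite mulr1 mul0r addr0.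
  rewrite bv_lt // av_lt //; apply: (is_gcd1_comaximal hEDD).
  by apply/hSAco/rev_lt.
have ch_a' i : rdvd (a' i.+1) (a' i).
  case: (ltnP i.+1 n) => ni; last by rewrite a'_ge //; exists (a' i); rewrite mulr1.
  rewrite !a'_lt // ?(ltnW ni) // -(subnSK ni); apply: cha.
  by rewrite subnSK // rev_lt // ltnW.
have nuE (i : 'I_r) : (nseq n 1 ++ nu)`_(n + i) = tnth nu i.
  by rewrite nth_cat size_nseq ltnNge leq_addr addKn (tnth_nth 0).
have deltaE (i : 'I_r) : (nseq n (beta * gamma) ++ delta)`_(n + i) = tnth delta i.
  by rewrite nth_cat size_nseq ltnNge leq_addr addKn (tnth_nth 0).
have nir (i : 'I_r) : (n + i < n + r)%N by rewrite ltn_add2l.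
have nu0 (i : 'I_r) : tnth nu i != 0 by have [] := hSP0 _ (nir i); rewrite nuE.
have delta0 (i : 'I_r) : tnth delta i != 0.
  by have [] := hSP0 _ (nir i); rewrite deltaE.
have dE (i : 'I_r) : beta * gamma * tnth nu i = d`_(n + i) * tnth delta i.
  by rewrite -nuE ed // deltaE.
have co_nu_delta (i : 'I_r) : comaximal (tnth nu i) (tnth delta i).
  by apply: (is_gcd1_comaximal hEDD); rewrite -nuE -deltaE; apply: hSPco.
have mu0 i : mu i != 0.
  by apply: contraNneq (delta0 i) => h; rewrite hdt h mulr0.
have sigma0 i : sigma i != 0.
  by apply: contraNneq (nu0 i) => h; rewrite hnt h mulr0.
pose num i := at_ i * nt_ i; pose den i := bt_ i * dt_ i.
have num_eq i : num i * (mu i * sigma i) = av i * tnth nu i.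
  by rewrite /av hat hnt /num; ring.
have den_eq i : den i * (mu i * sigma i) = bv i * tnth delta i.
  by rewrite /bv hbt hdt /den; ring.
have num0 i : num i != 0.
  apply: contraTneq (mulf_neq0 (av0 i) (nu0 i)) => h.
  by rewrite -num_eq h mul0r eqxx.
have den0 i : den i != 0.
  apply: contraTneq (mulf_neq0 (bv0 i) (delta0 i)) => h.
  by rewrite -den_eq h mul0r eqxx.
(* Four comaximal pairs are needed: two arise by dividing out the gcds [mu] and [sigma], and two are
   inherited from the reduced fractions in S_A and S_P. *)
have co_num_den i : comaximal (num i) (den i).
  have co_at_dt : comaximal (at_ i) (dt_ i).
    by apply: (is_gcd_comaximal hEDD (hmu i)); rewrite ?mu0.
  have co_bt_nt : comaximal (bt_ i) (nt_ i).
    by apply: (is_gcd_comaximal hEDD (hsigma i)); rewrite ?sigma0.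
  have co_at_bt : comaximal (at_ i) (bt_ i).
    apply: (@comaximal_factorl _ (mu i)); rewrite [mu i * _]mulrC -hat.
    apply/comaximalC/(@comaximal_factorl _ (sigma i)).
    rewrite [sigma i * _]mulrC -hbt.
    exact: co_bv_av.
  have co_nt_dt : comaximal (nt_ i) (dt_ i).
    apply: (@comaximal_factorl _ (sigma i)); rewrite [sigma i * _]mulrC -hnt.
    apply/comaximalC/(@comaximal_factorl _ (mu i)); rewrite [mu i * _]mulrC -hdt.
    exact/comaximalC/co_nu_delta.
  apply: comaximalMl; apply/comaximalC/comaximalMl; apply/comaximalC => //.
  exact: comaximalC.
(* Cross-multiplied form of (alpha / (beta gamma)) (d_(n+i) / a'_i) = num_i / den_i, proved after
   multiplication by mu_i sigma_i. *)
have value (i : 'I_r) : alpha * d`_(n + i) * den i = beta * gamma * a' i * num i.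
  have ms0 : mu i * sigma i != 0 by rewrite mulf_neq0.
  apply: (mulIf ms0); rewrite -mulrA den_eq -[RHS]mulrA num_eq.
  transitivity (alpha * bv i * (d`_(n + i) * tnth delta i)); first by ring.
  by rewrite avbv -dE; ring.
have codomE (g : 'I_r -> R) x i (ir : (i < r)%N) :
    nth x (codom g) i = g (Ordinal ir).
  rewrite /codom (nth_map (Ordinal ir)) ?size_enum_ord //.
  by rewrite (nth_ord_enum _ (Ordinal ir)).
have sz (g : 'I_r -> R) : size (codom g) = r by rewrite size_codom card_ord.
rewrite /smith_mcmillan_form rG; split.
- by rewrite !sz.
- by move=> i ir; rewrite !(codomE _ _ _ ir); split;
    [apply: num0 | apply: den0].
- move=> i ir; pose i1 := Ordinal ir; pose i0 := Ordinal (ltnW ir).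
  rewrite !(codomE _ _ _ ir) !(codomE _ _ _ (ltnW ir)).
  have [y ey] : rdvd d`_(n + i) d`_(n + i.+1).
    by rewrite addnS; apply: chd; rewrite -addnS ltn_add2l.
  have [z ez] := ch_a' i.
  (* The ratio of consecutive fractions is y z, with y from the increasing chain [d] and z from the
     decreasing chain [a']. *)
  apply: (@lowest_terms_chain _ (num i0) (den i0) (num i1) (den i1) (y * z)) => //.
  have := value i1; have := value i0; rewrite /= ey ez => v0 v1.
  apply: (mulfI (mulf_neq0 bg0 (a'0 i.+1))).
  transitivity (beta * gamma * a' i.+1 * num i1 * den i0); first by ring.
  rewrite -v1; transitivity (y * den i1 * (alpha * d`_(n + i) * den i0)).
    by ring.
  by rewrite v0; ring.
- move=> i ir; rewrite !(codomE _ _ _ ir).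
  by apply: comaximal_is_gcd; apply: co_num_den.
exists U, V; split=> //.
rewrite eG -scalemxAr -scalemxAl eqW diag_fracE scale_dmx; apply: eq_dmx => i _ _.
case: (ltnP i r) => ir; last first.
  rewrite [d`_(n + i)]nth_default ?sd ?leq_add2l //.
  by rewrite [nth 0 (codom _) i]nth_default ?sz // tofrac0 !mul0r mulr0.
rewrite !(codomE _ _ _ ir) -/(num _) -/(den _) -/(a' _).
rewrite mulf_div; apply/eqP; rewrite eqr_div ?mulf_neq0 ?tofrac_eq0 //.
rewrite -!tofracM tofrac_eq [num _ * _]mulrC.
exact/eqP/(value (Ordinal ir)).
Qed.
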